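(* Let $A$ be an arbitrary commutative ring with unit, and let $\mathcal{A}(A)=1+XA[[X]]$ be the multiplicative group of formal power series with constant term $1$. Let $\star$ be the eñe product on $\mathcal{A}(A)$ and define the twisted eñe product by $$f\,\check\star\, g=(f\star g)^{-1}\qquad (f,g\in\mathcal{A}(A)),$$ where the inverse is the inverse in the multiplicative group $\mathcal{A}(A)$. Then the twisted eñe ring structure $(\mathcal{A}(A),\,.\,,\check\star)$ (whose ring addition is the multiplication of power series and whose ring multiplication is $\check\star$) coincides with the Big Witt ring $(\mathcal{A}(A),\,.\,,\star_w)$; that is, $f\star_w g=(f\star g)^{-1}$ for all $f,g\in\mathcal{A}(A)$.
   Context: Eñe product. For $n\ge 1$, in $\mathbb{Z}[X_1,\dots,X_n,Y_1,\dots,Y_n,T]$ write $\prod_{k=1}^n(1-X_kT)=1+\sum_{k=1}^n\Sigma_k(X)T^k$ and $\prod_{l=1}^n(1-Y_lT)=1+\sum_{l=1}^n\Sigma_l(Y)T^l$ (so $\Sigma_k$ is, up to the sign $(-1)^k$, the $k$-th elementary symmetric function). Let $C_n\in\mathbb{Z}[U_1,\dots,U_n,V_1,\dots,V_n]$ be the unique polynomial such that the coefficient of $T^n$ in $\prod_{k,l=1}^n(1-X_kY_lT)$ equals $C_n(\Sigma_1(X),\dots,\Sigma_n(X),\Sigma_1(Y),\dots,\Sigma_n(Y))$. For any commutative unitary ring $A$ and $f=1+\sum_{n\ge1}a_nX^n$, $g=1+\sum_{n\ge1}b_nX^n$ in $\mathcal{A}(A)$, the eñe product is $f\star g=1+\sum_{n\ge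 1}C_n(a_1,\dots,a_n,b_1,\dots,b_n)X^n$. Big Witt ring. For every commutative ring $A$, each $f\in\mathcal{A}(A)$ can be written uniquely as $f(X)=\prod_{k\ge1}(1-x_kX^k)^{-1}$ with $x_k\in A$; its ghost components are $W_n(f)=\sum_{d\mid n}d\,x_d^{n/d}\in A$, $n\ge1$. The Big Witt ring is $\mathcal{A}(A)$ with ring addition the multiplication of power series and ring multiplication $\star_w$ determined by $W_n(f\star_w g)=W_n(f)W_n(g)$ for all $n\geq 1$, in the universal sense: there are unique polynomials $M_n\in\mathbb{Z}[U_1,\dots,U_n,V_1,\dots,V_n]$ ($n\ge1$) with $\sum_{d\mid n}d\,M_d^{n/d}=\big(\sum_{d\mid n}d\,U_d^{n/d}\big)\big(\sum_{d\mid n}d\,V_d^{n/d}\big)$ for all $n\ge 1$, and for $f=\prod_k(1-x_kX^k)^{-1}$, $g=\prod_k(1-y_kX^k)^{-1}$ in $\mathcal{A}(A)$ one sets $f\star_w g=\prod_{k}(1-M_k(x_1,\dots,x_k,y_1,\dots,y_k)X^k)^{-1}$. *)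

(* Defs.v *)
From HB Require Import structures.
From Stdlib Require Import ClassicalEpsilon.
From mathcomp Require Import all_boot all_order all_algebra.
From mathcomp Require Import boolp.
From mathcomp Require Import mpoly.

Set Implicit Arguments.
Unset Strict Implicit.
Unset Printing Implicit Defensive.

Import GRing.Theory.
Local Open Scope ring_scope.

(** * The multiplicative group 1 + X A[[X]] *)

(* Rings are [comPzRingType], so that the zero ring is allowed. *)
Record unit_series (A : comPzRingType) := UnitSeries {
  coefs :> nat -> A;
  _ : coefs 0 == 1
}.

HB.instance Definition _ (A : comPzRingType) :=
  [isSub for @coefs A].
HB.instance Definition _ (A : comPzRingType) :=
  [Choice of unit_series A by <:].

Section UnitSeriesGroup.
Variable A : comPzRingType.
Implicit Types f g h : unit_series A.

Lemma coefs0 f : f 0 = 1.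
Proof. by case: f => f0 /= /eqP. Qed.

Lemma unit_seriesP f g : (forall n, f n = g n) -> f = g.
Proof. by move=> e; apply/val_inj/funext. Qed.

Definition us_one_coef (n : nat) : A := (n == 0)%:R.

Fact us_one_subproof : us_one_coef 0 == 1.
Proof. by []. Qed.

Definition us_one : unit_series A := UnitSeries us_one_subproof.

Definition us_mul_coef (f g : nat -> A) (n : nat) : A :=
  \sum_(i < n.+1) f i * g (n - i)%N.

Fact us_mul_subproof f g : us_mul_coef f g 0 == 1.
Proof. by rewrite /us_mul_coef big_ord1 !coefs0 mulr1. Qed.

Definition us_mul f g : unit_series A := UnitSeries (us_mul_subproof f g).

(* [us_inv_seq f n] lists the first n+1 coefficients of 1/f, computed by
   b_0 = 1 and b_n = - \sum_(i < n) b_i a_(n-i). *)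
Fixpoint us_inv_seq (f : nat -> A) (n : nat) : seq A :=
  if n is m.+1 then
    let s := us_inv_seq f m in
    rcons s (- \sum_(i < n) s`_i * f (n - i)%N)
  else [:: 1].

Definition us_inv_coef (f : nat -> A) (n : nat) : A := (us_inv_seq f n)`_n.

Fact us_inv_subproof f : us_inv_coef f 0 == 1.
Proof. by []. Qed.

Definition us_inv f : unit_series A := UnitSeries (us_inv_subproof f).

Fact us_mul_coefC (f g : nat -> A) n : us_mul_coef f g n = us_mul_coef g f n.
Proof.
rewrite /us_mul_coef (reindex_inj rev_ord_inj) /=.
by apply: eq_bigr => i _; rewrite subSS subKn 1?mulrC // -ltnS.
Qed.

Fact us_mulC : commutative us_mul.
Proof. by move=> f g; apply: unit_seriesP => n; apply: us_mul_coefC. Qed.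

Fact us_mulA : associative us_mul.
Proof.
move=> p q r; apply: unit_seriesP => n.
change (us_mul_coef p (us_mul_coef q r) n = us_mul_coef (us_mul_coef p q) r n).
rewrite [RHS]us_mul_coefC.
pose coef3 j k := p j * (q (n - j - k)%N * r k).
transitivity (\sum_(j < n.+1) \sum_(k < n.+1 | (k <= n - j)%N) coef3 j k).
  apply: eq_bigr => /= j _; rewrite us_mul_coefC big_distrr /=.
  rewrite (big_ord_narrow_leq (leq_subr _ _)).
  by apply: eq_bigr => k _; rewrite /coef3 [r _ * _]mulrC.
rewrite (exchange_big_dep predT) //=; apply: eq_bigr => k _.
transitivity (\sum_(j < n.+1 | (j <= n - k)%N) coef3 j k).
  apply: eq_bigl => j; rewrite -ltnS -(ltnS j) -!subSn ?leq_ord //.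
  by rewrite -subn_gt0 -(subn_gt0 j) -!subnDA addnC.
rewrite (big_ord_narrow_leq (leq_subr _ _)) [RHS]mulrC big_distrl /=.
by apply: eq_bigr => j _; rewrite /coef3 -!subnDA addnC mulrA.
Qed.

Fact us_mul1 : left_id us_one us_mul.
Proof.
move=> f; apply: unit_seriesP => n /=.
rewrite /us_mul_coef big_ord_recl /= mul1r subn0 big1 ?addr0 // => i _.
by rewrite mul0r.
Qed.

Fact us_size_inv_seq (f : nat -> A) n : size (us_inv_seq f n) = n.+1.
Proof. by elim: n => //= n IH; rewrite size_rcons IH. Qed.

Fact us_inv_seqE (f : nat -> A) n i :
  (i <= n)%N -> (us_inv_seq f n)`_i = us_inv_coef f i.
Proof.
elim: n => [|n IH]; first by case: i.
rewrite leq_eqVlt => /orP[/eqP -> //|lt_in].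
by rewrite /= nth_rcons us_size_inv_seq lt_in IH.
Qed.

Fact us_mulV : left_inverse us_one us_inv us_mul.
Proof.
move=> f; apply: unit_seriesP => -[|n]; first by rewrite !coefs0.
rewrite /=.
rewrite /us_mul_coef big_ord_recr /= subnn coefs0 mulr1.
rewrite {2}/us_inv_coef /= nth_rcons us_size_inv_seq ltnn eqxx.
apply/eqP; rewrite subr_eq0; apply/eqP.
by apply: eq_bigr => i _; rewrite us_inv_seqE // -ltnS.
Qed.

Fact us_mulr1 : right_id us_one us_mul.
Proof. by move=> f; rewrite us_mulC us_mul1. Qed.

Fact us_mulVr : right_inverse us_one us_inv us_mul.
Proof. by move=> f; rewrite us_mulC us_mulV. Qed.

HB.instance Definition _ := isGroup.Build (unit_series A)
  us_mulA us_mul1 us_mulr1 us_mulV us_mulVr.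

End UnitSeriesGroup.

(** * Evaluation of integer polynomials *)

(* The value in R of p in Z[U_1..U_n, V_1..V_n] at u_1, .., u_n, v_1, .., v_n.
   The first n variables of {mpoly int[n + n]} are the U's, the last n are the
   V's; sequences are indexed from 1, so u 0 and v 0 are never read.
   [mmap] is not used because it excludes the zero ring. *)
Definition eval2 (R : comPzRingType) (n : nat) (p : {mpoly int[n + n]})
    (u v : nat -> R) : R :=
  let h (i : 'I_(n + n)) :=
    match split i with inl j => u j.+1 | inr j => v j.+1 end in
  \sum_(m <- msupp p) (p@_m)%:~R * \prod_(i < n + n) h i ^+ m i.

Lemma eval2_mmap (R : comNzRingType) n (p : {mpoly int[n + n]}) (u v : nat -> R) :
  eval2 p u v =
  mmap intr (fun i => match split i with inl j => u j.+1 | inr j => v j.+1 end) p.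
Proof. by []. Qed.

(* Indexed from 1; the value 0 for k > n is a dummy. *)
Definition varU (n k : nat) : {mpoly int[n + n]} :=
  if insub k.-1 is Some i then 'X_(lshift n i) else 0.
Definition varV (n k : nat) : {mpoly int[n + n]} :=
  if insub k.-1 is Some i then 'X_(rshift n i) else 0.

(** * The ene product *)

(* The coefficient of T^k in (1 - z_1 T) ... (1 - z_n T). *)
Definition Sigma (R : comNzRingType) (n : nat) (z : nat -> R) (k : nat) : R :=
  (\prod_(1 <= i < n.+1) (1 - z i *: 'X))`_k.

(* Here the variables of {mpoly int[n + n]} play the role of X_1, .., X_n,
   Y_1, .., Y_n, and T is the indeterminate of {poly _}. *)
Definition ene_poly_spec (n : nat) (C : {mpoly int[n + n]}) : Prop :=
  (\prod_(1 <= k < n.+1) \prod_(1 <= l < n.+1)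
      (1 - (varU n k * varV n l) *: 'X))`_n
  = eval2 C (Sigma n (varU n)) (Sigma n (varV n)).

Definition ene_poly (n : nat) : {mpoly int[n + n]} :=
  epsilon (inhabits 0) (@ene_poly_spec n).

Section EneProduct.
Variable A : comPzRingType.
Implicit Types f g : unit_series A.

Definition ene_coef f g (n : nat) : A :=
  if n is 0 then 1 else eval2 (ene_poly n) f g.

Fact ene_subproof f g : ene_coef f g 0 == 1.
Proof. by []. Qed.

Definition ene f g : unit_series A := UnitSeries (ene_subproof f g).

Definition twisted_ene f g : unit_series A := ((ene f g)^-1)%g.

End EneProduct.

(** * The big Witt ring *)

(* The n-th ghost component of the Witt coordinates x_1, x_2, .. *)
Definition ghost (R : comPzRingType) (x : nat -> R) (n : nat) : R :=
  \sum_(d <- divisors n) x d ^+ (n %/ d) *+ d.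

(* [eval2 (M d) (varU n) (varV n)] is M_d viewed in Z[U_1..U_n, V_1..V_n], for
   d <= n.  M 0 is unconstrained and never used. *)
Definition witt_polys_spec (M : forall n, {mpoly int[n + n]}) : Prop :=
  forall n, (0 < n)%N ->
    ghost (fun d => eval2 (M d) (varU n) (varV n)) n
    = ghost (varU n) n * ghost (varV n) n.

Definition witt_polys : forall n, {mpoly int[n + n]} :=
  epsilon (inhabits (fun n => 0)) witt_polys_spec.

Section BigWitt.
Variable A : comPzRingType.
Implicit Types (f g : unit_series A) (x : nat -> A).

(* 1 - a X^k, for k > 0; the guard only makes the term well defined at k = 0. *)
Definition one_sub_coef (a : A) (k n : nat) : A :=
  (n == 0)%:R - a *+ ((0 < k)%N && (n == k)).

Fact one_sub_subproof a k : one_sub_coef a k 0 == 1.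
Proof. by case: k => [|k]; rewrite /one_sub_coef /= subr0. Qed.

Definition one_sub a k : unit_series A := UnitSeries (one_sub_subproof a k).

Definition witt_partial x (m : nat) : unit_series A :=
  (\prod_(1 <= k < m.+1) (one_sub (x k) k)^-1)%g.

(* The infinite product of the (1 - x_k X^k)^-1, k >= 1: its n-th coefficient is
   that of the first n factors, see [witt_prod_stable]. *)
Definition witt_prod_coef x (n : nat) : A := witt_partial x n n.

Fact witt_prod_subproof x : witt_prod_coef x 0 == 1.
Proof. by apply/eqP; apply: coefs0. Qed.

Definition witt_prod x : unit_series A := UnitSeries (witt_prod_subproof x).

Lemma us_mulE f g n :
  (f * g)%g n = \sum_(i < n.+1) f i * g (n - i)%N.
Proof. by []. Qed.

Lemma one_subV_low a k n :
  (n < k)%N -> ((one_sub a k)^-1)%g n = (n == 0)%:R.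
Proof.
case: n => [|n] lt_nk; first by rewrite coefs0.
have := mulVg (one_sub a k); move: (_^-1)%g => g g_inv.
have: (g * one_sub a k)%g n.+1 = 0 by rewrite g_inv.
rewrite us_mulE big_ord_recr /= subnn (eqP (one_sub_subproof a k)) mulr1.
rewrite big1 ?add0r // => -[i lt_in] _ /=.
rewrite /one_sub_coef subn_eq0 leqNgt lt_in (_ : _ == k = false).
  by rewrite andbF subr0 mulr0.
by apply/negbTE; rewrite neq_ltn (leq_ltn_trans (leq_subr _ _)).
Qed.

Lemma witt_prod_stable x m n :
  (n <= m)%N -> witt_partial x m n = witt_prod x n.
Proof.
elim: m => [|m IH]; first by rewrite leqn0 => /eqP ->.
rewrite leq_eqVlt => /orP[/eqP -> //|lt_nm].
rewrite -IH // /witt_partial [in LHS]big_nat_recr //.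
have := @one_subV_low (x m.+1) m.+1; move: (_^-1)%g => g g_low.
rewrite us_mulE big_ord_recr /= subnn coefs0 mulr1.
rewrite big1 ?add0r // => -[i lt_in] _ /=.
rewrite g_low; last exact: leq_ltn_trans (leq_subr _ _) lt_nm.
by rewrite subn_eq0 leqNgt lt_in mulr0.
Qed.

(* The x with f = \prod_(k >= 1) (1 - x_k X^k)^-1; unique for k >= 1, and x 0 is
   never used. *)
Definition witt_coord f : nat -> A :=
  epsilon (inhabits (fun=> 0)) (fun x => f = witt_prod x).

Definition witt_mul f g : unit_series A :=
  witt_prod (fun k => eval2 (witt_polys k) (witt_coord f) (witt_coord g)).

End BigWitt.

(* Main.v *)
(* In a torsion-free ring a series [f] in 1 + X A[[X]] is determined by its
   logarithmic derivative X f'/f, which is additive in [f] and whose n-th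
   coefficient is W_n on \prod_k (1 - x_k X^k)^-1 and the opposite of the n-th
   power sum on \prod_k (1 - z_k X).  For f = \prod_k (1 - z_k X) and
   g = \prod_l (1 - w_l X), the power sums of the z_k w_l are the products of
   those of z and w, so the logarithmic derivative of the ene product is minus
   the product of those of f and g.  Over algC every series agrees with such a
   product up to any given order; an integer polynomial vanishing at all integer
   points is zero, so this identity holds over Z[U, V].  There, the inverse of
   the ene product of two Witt products thus has the ghost components required of
   the big Witt product: its Witt coordinates are the Witt polynomials, and
   specialization gives the result over any ring. *)
Require Import Defs.
From HB Require Import structures.
From Stdlib Require Import ClassicalEpsilon.
From mathcomp Require Import all_boot all_algebra perm.
From mathcomp Require Import boolp mpoly algC.

Set Implicit Arguments.
Unset Strict Implicit.
Unset Printing Implicit Defensive.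

Import GRing.Theory.
Local Open Scope ring_scope.

(** * Logarithmic derivatives *)

Section Convolution.
Variable A : comNzRingType.
Implicit Types (p q r : nat -> A) (f g h : unit_series A).

Lemma coef_poly_mul n p q k : (k <= n)%N ->
  ((\poly_(i < n.+1) p i) * (\poly_(i < n.+1) q i))`_k = us_mul_coef p q k.
Proof.
move=> le_kn; rewrite coefM; apply: eq_bigr => -[i /= lt_ik] _.
by rewrite !coef_poly !ltnS (leq_trans _ le_kn) // (leq_trans (leq_subr _ _)).
Qed.

(** [us_mulA] concerns series with constant term 1, but [euler f] and [dlog f] have constant term 0.
    Associativity for bare sequences comes from polynomials truncated at degree n. *)
Lemma us_mul_coefA p q r :
  us_mul_coef p (us_mul_coef q r) = us_mul_coef (us_mul_coef p q) r.
Proof.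
apply/funext => n; pose P s := \poly_(i < n.+1) (s i : A).
have E s t k : (k <= n)%N -> (P s * P t)`_k = us_mul_coef s t k.
  exact: coef_poly_mul.
transitivity ((P p * (P q * P r))`_n).
  rewrite coefM; apply: eq_bigr => -[i /= lt_in] _.
  by rewrite E ?leq_subr // coef_poly lt_in.
rewrite mulrA coefM; apply: eq_bigr => -[i /= lt_in] _.
by rewrite E // coef_poly ltnS leq_subr.
Qed.

Lemma us_mul_coef1 p : us_mul_coef p (1 : unit_series A)%g = p.
Proof.
apply/funext => n; rewrite /us_mul_coef big_ord_recr subnn /= mulr1 big1 ?add0r //.
by move=> [i lt_in] _ /=; rewrite /us_one_coef subn_eq0 leqNgt lt_in mulr0.
Qed.

Lemma us_mul_coefDl p q r :
  us_mul_coef (fun n => p n + q n) r =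
  fun n => us_mul_coef p r n + us_mul_coef q r n.
Proof.
apply/funext => n; rewrite /us_mul_coef -big_split.
by apply: eq_bigr => i _; rewrite mulrDl.
Qed.

(** The operator X d/dX. *)
Definition euler p : nat -> A := fun n => p n *+ n.

Lemma euler_mul p q :
  euler (us_mul_coef p q) =
  fun n => us_mul_coef (euler p) q n + us_mul_coef p (euler q) n.
Proof.
apply/funext => n; rewrite /euler /us_mul_coef -big_split -sumrMnl.
apply: eq_bigr => -[i lt_in] _ /=.
by rewrite mulrnAl mulrnAr -mulrnDr subnKC.
Qed.

(** The coefficients of X f'/f. *)
Definition dlog f : nat -> A := us_mul_coef (euler f) (f^-1)%g.

Lemma dlog_unique f p : us_mul_coef p f = euler f -> p = dlog f.
Proof.
move=> e; rewrite /dlog -e -us_mul_coefA.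
have -> : us_mul_coef f (f^-1)%g = (1 : unit_series A)%g by rewrite -(mulgV f).
by rewrite us_mul_coef1.
Qed.

Lemma dlogP f : us_mul_coef (dlog f) f = euler f.
Proof.
rewrite /dlog -us_mul_coefA.
have -> : us_mul_coef (f^-1)%g f = (1 : unit_series A)%g by rewrite -(mulVg f).
by rewrite us_mul_coef1.
Qed.

Lemma dlog0 f : dlog f 0 = 0.
Proof. by rewrite /dlog /us_mul_coef big_ord1 /euler mulr0n mul0r. Qed.

Lemma dlogM f g n : dlog (f * g)%g n = dlog f n + dlog g n.
Proof.
suff -> : dlog (f * g)%g = (fun n => dlog f n + dlog g n) by [].
apply/esym/dlog_unique; rewrite us_mul_coefDl.
change (coefs (f * g)%g) with (us_mul_coef f g).
rewrite euler_mul us_mul_coefA dlogP; apply/funext => m; congr (_ + _).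
have -> : us_mul_coef f g = us_mul_coef g f.
  by apply/funext => k; apply: us_mul_coefC.
by rewrite us_mul_coefA dlogP us_mul_coefC.
Qed.

Lemma dlog1 n : dlog 1%g n = 0.
Proof.
suff -> : dlog 1%g = (fun=> 0) by [].
apply/esym/dlog_unique/funext => m; rewrite /us_mul_coef big1 => [|i _].
  by rewrite /euler; case: m => //= m; rewrite /us_one_coef mul0rn.
by rewrite mul0r.
Qed.

Lemma dlogV f n : dlog (f^-1)%g n = - dlog f n.
Proof. by apply/eqP; rewrite -addr_eq0 -dlogM mulVg dlog1. Qed.

Lemma dlog_prod I (r : seq I) (F : I -> unit_series A) n :
  dlog (\prod_(i <- r) F i)%g n = \sum_(i <- r) dlog (F i) n.
Proof.
elim: r => [|i r IH]; first by rewrite !big_nil dlog1.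
by rewrite !big_cons dlogM IH.
Qed.

Lemma us_mul_one_sub p (a : A) k n : (0 < k)%N ->
  us_mul_coef p (one_sub a k) n =
  p n - (if (k <= n)%N then p (n - k)%N * a else 0).
Proof.
move=> k_gt0; rewrite us_mul_coefC /us_mul_coef /= /one_sub_coef.
under eq_bigr do rewrite mulrBl.
rewrite big_split /= sumrN; congr (_ - _).
  rewrite big_ord_recl /= mul1r subn0 big1 ?addr0 // => i _.
  by rewrite mul0r.
rewrite k_gt0; case: leqP => [le_kn|lt_nk].
  rewrite (bigD1 (Ordinal (le_kn : k < n.+1)%N)) //= eqxx mulr1n mulrC.
  rewrite big1 ?addr0 // => -[i lt_in] /=; rewrite -val_eqE /= => /negbTE ->.
  by rewrite mulr0n mul0r.
rewrite big1 // => -[i lt_in] _ /=; rewrite (_ : i == k = false) ?mul0r //.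
by apply/negbTE; rewrite neq_ltn (leq_trans lt_in lt_nk).
Qed.

(** The geometric expansion of -k a X^k / (1 - a X^k). *)
Lemma dlog_one_sub (a : A) k n : (0 < k)%N ->
  dlog (one_sub a k) n =
  if (k %| n)%N && (0 < n)%N then - (a ^+ (n %/ k) *+ k) else 0.
Proof.
move=> k_gt0.
pose L n : A := if (k %| n)%N && (0 < n)%N then - (a ^+ (n %/ k) *+ k) else 0.
suff <- : L = dlog (one_sub a k) by [].
apply: dlog_unique; apply/funext => m; rewrite us_mul_one_sub // /euler /=.
rewrite /one_sub_coef k_gt0 /=.
have [->|m_neq0] := eqVneq m 0%N.
  rewrite mulr0n /L dvdn0 /= leqNgt k_gt0 /= subr0 //.
rewrite sub0r; have [le_km|lt_mk] := leqP k m; last first.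
  rewrite subr0 ltn_eqF // mulr0n oppr0 mul0rn /L.
  case: ifP => // /andP[/dvdn_leq le_km m_gt0].
  by move: lt_mk; rewrite ltnNge le_km.
(* For m = k the term [L (m - k)] is [L 0] = 0; for larger m, [L m] and [L (m - k) * a] cancel or
   both vanish. *)
have [->|m_neqk] := eqVneq m k.
  by rewrite /L dvdnn k_gt0 divnn k_gt0 subnn andbF mul0r subr0 expr1 mulNrn.
rewrite mulr0n oppr0 mul0rn /L dvdn_subl // lt0n m_neq0 subn_gt0.
rewrite ltn_neqAle eq_sym m_neqk le_km /= !andbT.
case: ifP => [/dvdnP[q Dm]|_]; last by rewrite mul0r subr0.
have q_gt0 : (0 < q)%N by case: q Dm m_neq0 => // ->.
have -> : (m - k = q.-1 * k)%N by rewrite Dm -{2}(mul1n k) -mulnBl subn1.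
rewrite Dm !mulnK // mulNr mulrnAl -exprSr prednK //.
by rewrite subrr.
Qed.

(** Congruence modulo X^(n+1). *)
Definition agree n p q := forall i, (i <= n)%N -> p i = q i.

Lemma agree_mul n f f' g g' :
  agree n f f' -> agree n g g' -> agree n (f * g)%g (f' * g')%g.
Proof.
move=> ef eg i le_in; rewrite !us_mulE; apply: eq_bigr => -[j lt_ji] _ /=.
by rewrite ef ?eg ?(leq_trans (leq_subr _ _)) // (leq_trans _ le_in).
Qed.

(** Multiply the congruence of g and f by f^-1 on the left and g^-1 on the right. *)
Lemma agree_inv n f g : agree n f g -> agree n (f^-1)%g (g^-1)%g.
Proof.
move=> efg; have: agree n (f^-1 * g * g^-1)%g (f^-1 * f * g^-1)%g.
  by apply: agree_mul => //; apply: agree_mul => // i le_in; rewrite efg.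
by rewrite mulVg mul1g -mulgA mulgV mulg1.
Qed.

Lemma agree_dlog n f g : agree n f g -> agree n (dlog f) (dlog g).
Proof.
move=> efg i le_in; apply: eq_bigr => -[j lt_ji] _ /=.
have le_jn : (j <= n)%N by rewrite (leq_trans _ le_in).
rewrite /euler efg //; congr (_ * _).
by apply: (agree_inv efg); rewrite (leq_trans (leq_subr _ _)).
Qed.

(** Since [dlog f] has no constant term, X f' = [dlog f] * f expresses m f_m through [dlog f] and
    the f_i with i < m; torsion-freeness then allows cancelling m. *)
Lemma agree_of_dlog n f g : (forall (x : A) m, (0 < m)%N -> x *+ m = 0 -> x = 0) ->
  agree n (dlog f) (dlog g) -> agree n f g.
Proof.
move=> tf eL; elim/ltn_ind => -[|m] IH le_mn; first by rewrite !coefs0.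
have rec h : h m.+1 *+ m.+1 = \sum_(i < m.+1) dlog h i.+1 * h (m - i)%N.
  have := congr1 (fun p => p m.+1) (dlogP h); rewrite /euler /= => <-.
  by rewrite /us_mul_coef big_ord_recl dlog0 mul0r add0r.
apply/eqP; rewrite -subr_eq0; apply/eqP; apply: (tf _ m.+1) => //.
rewrite mulrnBl !rec; apply/eqP; rewrite subr_eq0; apply/eqP.
apply: eq_bigr => -[i lt_im] _ /=; rewrite eL ?(leq_trans _ le_mn) //.
by rewrite IH // ?ltnS ?leq_subr // (leq_trans (leq_subr _ _)) // ltnW.
Qed.

(** By additivity, the factor (1 - x_k X^k)^-1 contributes k x_k^(n/k) when k divides n, and 0
    otherwise. *)
Lemma dlog_witt_prod (x : nat -> A) n : (0 < n)%N -> dlog (witt_prod x) n = ghost x n.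
Proof.
move=> n_gt0.
have -> : dlog (witt_prod x) n = dlog (witt_partial x n) n.
  by apply: (@agree_dlog n) => // i le_in; rewrite witt_prod_stable.
rewrite /witt_partial dlog_prod /ghost.
rewrite (eq_big_nat _ _
  (F2 := fun d => if (d %| n)%N then x d ^+ (n %/ d) *+ d else 0)); last first.
  move=> k /andP[k_gt0 _]; rewrite dlogV dlog_one_sub // n_gt0 andbT.
  by case: ifP; rewrite ?oppr0 ?opprK.
rewrite -big_mkcond -big_filter; apply: perm_big; apply: uniq_perm.
- by rewrite filter_uniq // iota_uniq.
- exact: divisors_uniq.
move=> d; rewrite mem_filter mem_index_iota -dvdn_divisors // ltnS.
by case: (boolP (d %| n)%N) => //= dn; rewrite (dvdn_leq n_gt0 dn) (dvdn_gt0 n_gt0 dn).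
Qed.

End Convolution.

(** * Witt coordinates *)

Section WittCoordinates.
Variable A : comNzRingType.
Implicit Types (x y : nat -> A) (f : unit_series A).

Lemma eq_witt_partial m x y :
  (forall k, (0 < k <= m)%N -> x k = y k) -> witt_partial x m = witt_partial y m.
Proof. by move=> exy; apply: eq_big_nat => k k_le; rewrite exy. Qed.

Lemma agree_witt_prod n x y :
  (forall k, (0 < k <= n)%N -> x k = y k) -> agree n (witt_prod x) (witt_prod y).
Proof.
move=> exy i le_in; rewrite -!(witt_prod_stable _ le_in).
by rewrite (eq_witt_partial exy).
Qed.

(** Modulo X^(n+2) the last factor is 1 + x_(n+1) X^(n+1). This triangularity gives both uniqueness
    and existence of Witt coordinates. *)
Lemma witt_prodS x n : witt_prod x n.+1 = witt_partial x n n.+1 + x n.+1.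
Proof.
rewrite -(witt_prod_stable x (leqnn n.+1)) /witt_partial [in LHS]big_nat_recr //.
have := @one_subV_low A (x n.+1) n.+1.
have : us_mul_coef (one_sub (x n.+1) n.+1)^-1%g (one_sub (x n.+1) n.+1) n.+1 = 0.
  exact: (congr1 (fun h : unit_series A => h n.+1) (mulVg _)).
move: (_^-1)%g => g; rewrite us_mul_one_sub // leqnn subnn coefs0 mul1r => top low.
have {top} top : g n.+1 = x n.+1 by apply/eqP; rewrite -subr_eq0 top.
rewrite us_mulE big_ord_recr big_ord_recl /= subnn subn0 !coefs0 mul1r mulr1 top.
rewrite big1 ?addr0 1?addrC // => -[i lt_in] _ /=.
by rewrite subSS low ?ltnS ?leq_subr // subn_eq0 leqNgt lt_in mulr0.
Qed.

Lemma witt_prod_inj n x y : agree n (witt_prod x) (witt_prod y) ->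
  forall k, (0 < k <= n)%N -> x k = y k.
Proof.
move=> exy; elim/ltn_ind => -[|k] IH // /andP[_ lt_kn].
have := exy _ lt_kn; rewrite !witt_prodS (@eq_witt_partial k x y).
  by move/addrI.
by move=> i /andP[i_gt0 le_ik]; rewrite IH // i_gt0 (leq_trans le_ik) // ltnW.
Qed.

(** Solves [witt_prodS] for the coordinates degree by degree; entry 0 is a dummy. *)
Fixpoint witt_coord_seq f n : seq A :=
  if n is m.+1 then
    let s := witt_coord_seq f m in
    rcons s (f n - witt_partial (nth 0 s) m n)
  else [:: 0].

Lemma witt_prod_surj f : exists x, f = witt_prod x.
Proof.
have size_s n : size (witt_coord_seq f n) = n.+1.
  by elim: n => //= n IH; rewrite size_rcons IH.
pose x n := (witt_coord_seq f n)`_n.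
have nth_s n k : (k <= n)%N -> (witt_coord_seq f n)`_k = x k.
  elim: n => [|n IH]; first by case: k.
  rewrite leq_eqVlt => /orP[/eqP -> //|lt_kn].
  by rewrite /= nth_rcons size_s lt_kn IH.
exists x; apply: unit_seriesP => -[|n]; first by rewrite !coefs0.
rewrite witt_prodS {2}/x /= nth_rcons size_s ltnn eqxx.
rewrite (@eq_witt_partial n x (nth 0 (witt_coord_seq f n))).
  by rewrite addrC subrK.
by move=> k /andP[_ /nth_s].
Qed.

Lemma witt_coordK f : witt_prod (witt_coord f) = f.
Proof.
by rewrite -(epsilon_spec (inhabits (fun=> 0)) _ (witt_prod_surj f)).
Qed.

End WittCoordinates.

(** * Functoriality in the coefficient ring *)

Section Naturality.
Variables (A B : comNzRingType) (phi : {rmorphism A -> B}).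
Implicit Types (x : nat -> A) (f g : unit_series A).

Fact us_map_subproof f : phi (f 0) == 1.
Proof. by rewrite coefs0 rmorph1. Qed.

Definition us_map f : unit_series B := @UnitSeries B (phi \o f) (us_map_subproof f).

Lemma us_mapM f g : us_map (f * g)%g = (us_map f * us_map g)%g.
Proof.
apply: unit_seriesP => n; rewrite us_mulE /= rmorph_sum.
by apply: eq_bigr => i _; rewrite rmorphM.
Qed.

Lemma us_map1 : us_map 1%g = 1%g.
Proof. by apply: unit_seriesP => n; apply: (rmorph_nat phi). Qed.

Lemma us_mapV f : us_map (f^-1)%g = ((us_map f)^-1)%g.
Proof. by apply: (mulIg (us_map f)); rewrite -us_mapM !mulVg us_map1. Qed.

Lemma us_map_one_sub a k : us_map (one_sub a k) = one_sub (phi a) k.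
Proof.
by apply: unit_seriesP => n; rewrite /= /one_sub_coef rmorphB !rmorphMn rmorph1.
Qed.

Lemma us_map_witt_prod x : us_map (witt_prod x) = witt_prod (phi \o x).
Proof.
have E m : us_map (witt_partial x m) = witt_partial (phi \o x) m.
  rewrite /witt_partial (big_morph _ us_mapM us_map1).
  by apply: eq_bigr => k _; rewrite us_mapV us_map_one_sub.
apply: unit_seriesP => n.
by rewrite -(witt_prod_stable _ (leqnn n)) -E.
Qed.

Lemma euler_map f n : euler (us_map f) n = phi (euler f n).
Proof. by rewrite /euler rmorphMn. Qed.

Lemma dlog_map f n : dlog (us_map f) n = phi (dlog f n).
Proof.
rewrite /dlog -us_mapV /us_mul_coef rmorph_sum; apply: eq_bigr => i _.
by rewrite rmorphM euler_map.
Qed.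

Lemma ghost_map x n : ghost (phi \o x) n = phi (ghost x n).
Proof.
by rewrite /ghost rmorph_sum; apply: eq_bigr => d _; rewrite rmorphMn rmorphXn.
Qed.

Lemma eval2_map n (p : {mpoly int[n + n]}) u v :
  eval2 p (phi \o u) (phi \o v) = phi (eval2 p u v).
Proof.
rewrite /eval2 rmorph_sum; apply: eq_bigr => m _.
rewrite rmorphM rmorph_int rmorph_prod; congr (_ * _); apply: eq_bigr => i _.
by rewrite rmorphXn; case: (split i).
Qed.

Lemma us_map_ene f g : us_map (ene f g) = ene (us_map f) (us_map g).
Proof.
apply: unit_seriesP => -[|n]; first by rewrite !coefs0.
by rewrite /= eval2_map.
Qed.

Lemma us_map_twisted_ene f g :
  us_map (twisted_ene f g) = twisted_ene (us_map f) (us_map g).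
Proof. by rewrite /twisted_ene us_mapV us_map_ene. Qed.

End Naturality.

(** * Evaluation and truncation *)

Section Evaluation.
Variable R : comNzRingType.
Implicit Types (u v : nat -> R).

Lemma eq_eval2 n (p : {mpoly int[n + n]}) u v u' v' :
  (forall k, (0 < k <= n)%N -> u k = u' k) ->
  (forall k, (0 < k <= n)%N -> v k = v' k) -> eval2 p u v = eval2 p u' v'.
Proof.
move=> eu ev; apply: eq_bigr => m _; congr (_ * _); apply: eq_bigr => i _.
by case: (split i) => j; rewrite ?eu ?ev /=.
Qed.

Lemma agree_ene n (f g f' g' : unit_series R) :
  agree n f f' -> agree n g g' -> agree n (ene f g) (ene f' g').
Proof.
move=> ef eg [|i] le_in //=.
by apply: eq_eval2 => k /andP[_ le_ki]; rewrite ?ef ?eg // (leq_trans le_ki).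
Qed.

Lemma agree_twisted_ene n (f g f' g' : unit_series R) :
  agree n f f' -> agree n g g' -> agree n (twisted_ene f g) (twisted_ene f' g').
Proof. by move=> ef eg; apply/agree_inv/agree_ene. Qed.

Definition point n u v (i : 'I_(n + n)) : R :=
  match split i with inl j => u j.+1 | inr j => v j.+1 end.

(** [eval2] as a ring morphism, so that identities between generic series can be specialized. *)
Definition eval_at n u v : {rmorphism {mpoly int[n + n]} -> R} :=
  mmap intr (point u v).

Lemma eval_atE n u v (p : {mpoly int[n + n]}) : eval_at n u v p = eval2 p u v.
Proof. by rewrite eval2_mmap. Qed.

Lemma eval_at_varU n u v k : (0 < k <= n)%N -> eval_at n u v (varU n k) = u k.
Proof.
case: k => // k /= lt_kn; rewrite /varU /= insubT /= mmapX mmap1U /point.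
by rewrite (unsplitK (inl _)).
Qed.

Lemma eval_at_varV n u v k : (0 < k <= n)%N -> eval_at n u v (varV n k) = v k.
Proof.
case: k => // k /= lt_kn; rewrite /varV /= insubT /= mmapX mmap1U /point.
by rewrite (unsplitK (inr _)).
Qed.

End Evaluation.

(** * Existence of the ene polynomials *)

Section LinearFactors.
Variable R : comNzRingType.
Implicit Types (r : seq R) (z : nat -> R).

(** \prod (1 - c X) is the reversal of \prod (X - c). *)
Lemma coef_prod_one_subX r k :
  (\prod_(c <- r) (1 - c *: 'X))`_k =
  if (k <= size r)%N then (\prod_(c <- r) ('X - c%:P))`_(size r - k) else 0.
Proof.
elim: r k => [|c r IH] k; first by rewrite !big_nil !coef1; case: k.
rewrite !big_cons mulrBl mul1r coefB -scalerAl coefZ coefXM.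
rewrite mulrBl coefB coefXM coefCM /= !IH.
have top : (\prod_(c <- r) ('X - c%:P))`_(size r).+1 = 0.
  by rewrite nth_default // size_prod_XsubC.
case: k => [|k] /=; first by rewrite !subn0 top !mulr0 subr0.
rewrite subSS ltnS; have [lt_kr|] := ltnP k (size r).
  by rewrite (ltnW lt_kr) subn_eq0 leqNgt lt_kr -subnS.
rewrite leq_eqVlt => /orP[/eqP <-|lt_rk]; first by rewrite leqnn subnn.
by rewrite leqNgt lt_rk mulr0 subr0.
Qed.

Lemma Sigma_seq n r k : size r = n ->
  Sigma n (fun i => r`_i.-1) k = (\prod_(c <- r) (1 - c *: 'X))`_k.
Proof. by move=> <-; rewrite /Sigma big_add1 [in RHS](big_nth 0). Qed.

Lemma Sigma0 n z : Sigma n z 0 = 1.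
Proof.
rewrite /Sigma -horner_coef0 horner_prod big1 // => i _.
by rewrite !hornerE subr0.
Qed.

Lemma size_prod_one_subX n z :
  (size (\prod_(1 <= i < n.+1) (1 - z i *: 'X) : {poly R})%R <= n.+1)%N.
Proof.
have -> : \prod_(1 <= i < n.+1) (1 - z i *: 'X) =
          \prod_(c <- mkseq (fun i => z i.+1) n) (1 - c *: 'X).
  by rewrite big_add1 big_map /index_iota subn0.
apply/leq_sizeP => j lt_nj.
by rewrite coef_prod_one_subX size_mkseq leqNgt lt_nj.
Qed.

(** Substitute a T for T in \prod_l (1 - z_l T). *)
Lemma prod_one_sub_scaled n z a :
  \prod_(1 <= l < n.+1) (1 - (a * z l) *: 'X) =
  \sum_(l < n.+1) (Sigma n z l * a ^+ l) *: 'X^l :> {poly R}.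
Proof.
transitivity ((\prod_(1 <= l < n.+1) (1 - z l *: 'X)) \Po (a *: 'X)).
  rewrite rmorph_prod; apply: eq_bigr => l _.
  by rewrite rmorphB rmorph1 /= comp_polyZ comp_polyX scalerA mulrC.
rewrite /comp_poly (@horner_coef_wide _ n.+1); last first.
  by rewrite size_map_polyC size_prod_one_subX.
by apply: eq_bigr => l _; rewrite coef_map exprZn mul_polyC scalerA.
Qed.

Lemma Sigma_roots n z k : (k <= n)%N ->
  Sigma n z k = (\prod_(c <- [tuple z i.+1 | i < n]) ('X - c%:P))`_(n - k).
Proof.
move=> le_kn; have := coef_prod_one_subX [tuple z i.+1 | i < n] k.
rewrite size_tuple le_kn => <-; rewrite big_tuple /Sigma big_add1 big_mkord.
by under [in RHS]eq_bigr do rewrite tnth_mktuple.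
Qed.

Lemma coef_prod_one_sub I (s : seq I) (F : I -> {poly R}) (G : I -> unit_series R) :
  (forall i k, (F i)`_k = G i k) ->
  forall k, (\prod_(i <- s) F i)`_k = (\prod_(i <- s) G i)%g k.
Proof.
move=> eFG; elim: s => [|i s IH] k; first by rewrite !big_nil coef1.
rewrite !big_cons coefM us_mulE; apply: eq_bigr => j _.
by rewrite eFG IH.
Qed.

Lemma coef_one_subX (a : R) k : (1 - a *: 'X)`_k = one_sub a 1 k.
Proof. by rewrite coefB coefZ coef1 coefX /= /one_sub_coef mulr_natr. Qed.

End LinearFactors.

(** The z_i are the roots of X^n + a_1 X^(n-1) + .. + a_n, the reversal of the truncation of a; it
    is monic because a_0 = 1. *)
Lemma Sigma_closed (K : closedFieldType) (a : nat -> K) n : a 0%N = 1 ->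
  exists z, forall m, (m <= n)%N -> Sigma n z m = a m.
Proof.
move=> a0; pose p := \poly_(i < n.+1) a (n - i)%N.
have size_p : size p = n.+1 by rewrite size_poly_eq // subnn a0 oner_neq0.
have [r Dp] := closed_field_poly_normal p.
have lead_p : lead_coef p = 1 by rewrite lead_coefE size_p coef_poly ltnSn subnn.
rewrite lead_p scale1r in Dp.
have size_r : size r = n by apply: succn_inj; rewrite -size_p Dp size_prod_XsubC.
exists (fun i => r`_i.-1) => m le_mn.
rewrite Sigma_seq // coef_prod_one_subX size_r le_mn -Dp coef_poly ltnS leq_subr.
by rewrite subKn.
Qed.

Lemma rmorph_mmap n (R : nzRingType) (S S' : nzRingType) (f : R -> S)
    (h : 'I_n -> S) (g : {rmorphism S -> S'}) (p : {mpoly R[n]}) :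
  g (mmap f h p) = mmap (g \o f) (g \o h) p.
Proof.
rewrite /mmap rmorph_sum; apply: eq_bigr => m _; rewrite rmorphM; congr (_ * _).
by rewrite /mmap1 rmorph_prod; apply: eq_bigr => i _; rewrite rmorphXn.
Qed.

Lemma eq_mmap n (R S : nzRingType) (f f' : R -> S) (h h' : 'I_n -> S) (p : {mpoly R[n]}) :
  f =1 f' -> h =1 h' -> mmap f h p = mmap f' h' p.
Proof.
move=> ef eh; apply: eq_bigr => m _; rewrite ef; congr (_ * _).
exact: mmap1_eq.
Qed.

Lemma varUE n (k : 'I_n) : varU n k.+1 = 'X_(lshift n k).
Proof. by rewrite /varU /= valK. Qed.

Lemma varVE n (k : 'I_n) : varV n k.+1 = 'X_(rshift n k).
Proof. by rewrite /varV /= valK. Qed.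

(** Vieta's formulas: both sides are, up to sign, a coefficient of \prod (X - z_i). *)
Lemma mmap_mesym n (R : nzRingType) (S : idomainType) (f : {rmorphism R -> S})
    (z : nat -> S) k : (k <= n)%N ->
  mmap f (fun i : 'I_n => z i.+1) (mesym n R k) = (-1) ^+ k * Sigma n z k.
Proof.
move=> le_kn; rewrite Sigma_roots //.
have -> := mroots_coeff [tuple z i.+1 | i < n] (Ordinal (le_kn : k < n.+1)%N).
rewrite mulrA -exprMn mulrNN mulr1 expr1n mul1r.
rewrite /mesym /meval !rmorph_sum; apply: eq_bigr => h _.
rewrite !rmorph_prod; apply: eq_bigr => i _.
by rewrite /= !mmapX !mmap1U tnth_mktuple.
Qed.

(** Permuting the X_k only permutes the factors. *)
Lemma coef_prod_msym n (R : comNzRingType) (b : nat -> R) m :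
  (\prod_(k < n) \sum_(l < n.+1) (b l *: 'X_k ^+ l) *: 'X^l : {poly {mpoly R[n]}})`_m
    \is symmetric.
Proof.
apply/issymP => s; rewrite -coef_map rmorph_prod.
rewrite [in RHS](reindex_inj (@perm_inj _ s)) /=; congr ((polyseq _)`_m).
apply: eq_bigr => k _; rewrite rmorph_sum; apply: eq_bigr => l _.
rewrite /= map_polyZ map_polyXn; congr (_ *: _).
by rewrite /= msymZ rmorphXn /= {1}/msym mmapX mmap1U.
Qed.

(** The fundamental theorem of symmetric polynomials in X, applied over Z[V_1, .., V_n], yields a
    polynomial t in the elementary symmetric functions. *)
Lemma ene_poly_exists n : exists C, @ene_poly_spec n C.
Proof.
(* [V l] stands for Sigma_l(Y), so [V 0] is 1. *)
pose V (l : nat) : {mpoly int[n]} :=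
  if l is k.+1 then if insub k is Some i then 'X_i else 0 else 1.
have [t [Dt _]] := sym_fundamental (coef_prod_msym n V n).
pose psi0 : {rmorphism {mpoly int[n]} -> {mpoly int[n + n]}} :=
  mmap intr (fun l : 'I_n => 'X_(rshift n l)).
(* The elementary symmetric function e_(k+1) is (-1)^(k+1) Sigma_(k+1), hence the sign on
   U_(k+1). *)
pose C : {mpoly int[n + n]} :=
  mmap psi0 (fun k : 'I_n => (-1) ^+ k.+1 * 'X_(lshift n k)) t.
exists C; rewrite /ene_poly_spec.
(* With g = \prod_l (1 - Y_l T), the product over k and l is \prod_k g(X_k T),
   which is symmetric in X with coefficients in Z[Sigma_1(Y), .., Sigma_n(Y)]. *)
set SU := Sigma n (varU n); set SV := Sigma n (varV n).
pose phi0 : {rmorphism {mpoly int[n]} -> {mpoly int[n + n]}} :=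
  mmap intr (fun l : 'I_n => SV l.+1).
pose phi : {rmorphism {mpoly {mpoly int[n]}[n]} -> {mpoly int[n + n]}} :=
  mmap phi0 (fun k : 'I_n => varU n k.+1).
set D := (X in _ = X) in Dt.
(* [phi] sends V_l to Sigma_l(Y) and keeps X_k, so it maps [D] to the coefficient of the double
   product. *)
transitivity (phi D).
  rewrite /D -coef_map rmorph_prod big_add1 big_mkord /=; congr ((polyseq _)`_n).
  apply: eq_bigr => k _; rewrite prod_one_sub_scaled rmorph_sum.
  apply: eq_bigr => -[l lt_ln] _; rewrite /= map_polyZ map_polyXn; congr (_ *: _).
  rewrite /= mmapZ rmorphXn /= mmapX mmap1U; congr (_ * _).
  case: l lt_ln => [|l] lt_ln /=.
    by rewrite Sigma0 rmorph1.
  by rewrite (insubT (fun k => k < n)%N (lt_ln : l < n)%N) mmapX mmap1U.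
(* Both sides become values of t: compare the images of its coefficients and of its variables. *)
rewrite -Dt -eval_atE /C rmorph_mmap /comp_mpoly rmorph_mmap.
apply: eq_mmap => [c|k] /=.
  rewrite mmapC rmorph_mmap; apply: eq_mmap => [z|l] /=; first by rewrite rmorph_int.
  by rewrite -varVE eval_at_varV // ltn_ord.
rewrite tnth_mktuple mmap_mesym // rmorphM rmorphXn rmorphN1; congr (_ * _).
by rewrite -varUE eval_at_varU // ltn_ord.
Qed.

Lemma ene_polyP n : ene_poly_spec (ene_poly n).
Proof. exact: epsilon_spec (ene_poly_exists n). Qed.

(** * Logarithmic derivative of the ene product *)

Section EneRoots.
Variable R : comNzRingType.
Implicit Types (z w : nat -> R) (f g : unit_series R).

Definition roots_series n z : unit_series R :=
  (\prod_(1 <= k < n.+1) one_sub (z k) 1)%g.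

Definition ene_roots_series n z w : unit_series R :=
  (\prod_(1 <= k < n.+1) \prod_(1 <= l < n.+1) one_sub (z k * w l) 1)%g.

Lemma SigmaE n z k : Sigma n z k = roots_series n z k.
Proof. by apply: coef_prod_one_sub => i j; apply: coef_one_subX. Qed.

Lemma dlog_roots_series n z m : (0 < m)%N ->
  dlog (roots_series n z) m = - \sum_(1 <= k < n.+1) z k ^+ m.
Proof.
move=> m_gt0; rewrite dlog_prod -sumrN; apply: eq_bigr => k _.
by rewrite dlog_one_sub // dvd1n m_gt0 divn1.
Qed.

Lemma dlog_ene_roots_series n z w m :
  dlog (ene_roots_series n z w) m
  = - (dlog (roots_series n z) m * dlog (roots_series n w) m).
Proof.
case: m => [|m]; first by rewrite !dlog0 mul0r oppr0.
rewrite !dlog_roots_series // mulrNN mulr_suml dlog_prod -sumrN.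
apply: eq_bigr => k _; rewrite dlog_prod mulr_sumr -sumrN; apply: eq_bigr => l _.
by rewrite dlog_one_sub // dvd1n divn1 exprMn.
Qed.

(** Specialize the identity defining C_n at X = z and Y = w. This reaches only degree n, the number
    of roots being tied to it. *)
Lemma ene_roots n z w f g :
  agree n (roots_series n z) f -> agree n (roots_series n w) g ->
  ene f g n = ene_roots_series n z w n.
Proof.
case: n => [|n] ef eg; first by rewrite !coefs0.
have := congr1 (eval_at n.+1 z w) (ene_polyP n.+1).
have -> : (ene_roots_series n.+1 z w) n.+1 =
  (\prod_(1 <= k < n.+2) \prod_(1 <= l < n.+2) (1 - (z k * w l) *: 'X))`_n.+1.
  apply/esym/coef_prod_one_sub => k i; apply: coef_prod_one_sub => l j.
  exact: coef_one_subX.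
have mapS (v v' : nat -> _) :
    (forall k, (0 < k <= n.+1)%N -> eval_at n.+1 z w (v k) = v' k) ->
    forall k, eval_at n.+1 z w (Sigma n.+1 v k) = Sigma n.+1 v' k.
  move=> ev k; rewrite /Sigma -coef_map rmorph_prod; congr ((polyseq _)`_k).
  apply: eq_big_nat => i i_le.
  by rewrite rmorphB rmorph1 /= map_polyZ map_polyX /= ev.
rewrite -coef_map -eval2_map => E; rewrite /= -[LHS]/(eval2 _ f g).
rewrite (eq_eval2 (u := f) (v := g) (ene_poly n.+1)
  (u' := eval_at n.+1 z w \o Sigma n.+1 (varU n.+1))
  (v' := eval_at n.+1 z w \o Sigma n.+1 (varV n.+1))).
- rewrite -E rmorph_prod; congr ((polyseq _)`_n.+1); apply: eq_big_nat => k k_le.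
  rewrite rmorph_prod; apply: eq_big_nat => l l_le.
  rewrite rmorphB rmorph1 /= map_polyZ map_polyX.
  by rewrite [X in X *: _]rmorphM /= eval_at_varU // eval_at_varV.
- move=> k /andP[_ k_le]; rewrite /= (mapS _ z) => [|i i_le]; last exact: eval_at_varU.
  by rewrite SigmaE ef.
move=> k /andP[_ k_le]; rewrite /= (mapS _ w) => [|i i_le]; last exact: eval_at_varV.
by rewrite SigmaE eg.
Qed.

End EneRoots.

Lemma dlog_ene_closed (K : closedFieldType) (f g : unit_series K) n :
  [pchar K] =i pred0 -> dlog (ene f g) n = - (dlog f n * dlog g n).
Proof.
move=> pchar0.
have tf (x : K) m : (0 < m)%N -> x *+ m = 0 -> x = 0.
  move=> m_gt0 /eqP; rewrite -mulr_natr mulf_eq0 => /orP[/eqP //|].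
  by rewrite (proj1 (pcharf0P K) pchar0) => /eqP m0; rewrite m0 in m_gt0.
(* C_m is only specified for m + m roots, so the roots depend on the degree m;
   the resulting products are compared through their logarithmic derivatives. *)
have rootsP (h : unit_series K) m : exists z, agree m (roots_series m z) h.
  have [z zP] := Sigma_closed m (coefs0 h).
  by exists z => i /zP; rewrite SigmaE.
have P m : exists2 p : unit_series K, ene f g m = p m &
    agree m (dlog p) (fun i => - (dlog f i * dlog g i)).
  have [z ef] := rootsP f m; have [w eg] := rootsP g m.
  exists (ene_roots_series m z w); first exact: ene_roots.
  move=> i le_im; rewrite dlog_ene_roots_series.
  by rewrite (agree_dlog ef) // (agree_dlog eg).
(* The series p for n and q for m <= n have the same [dlog] up to degree m, hence the same
   coefficients there; so p agrees with [ene f g] up to degree n. *)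
have [p _ dp] := P n; rewrite -dp //; apply: (@agree_dlog _ n) => // m le_mn.
have [q -> dq] := P m; apply: (@agree_of_dlog _ m) => // i le_im.
by rewrite dq // dp // (leq_trans le_im).
Qed.

(** * Integer polynomials vanishing at all integer points *)

Lemma poly_int_eq0 (p : {poly int}) : (forall x, p.[x] = 0) -> p = 0.
Proof.
move=> p0; apply/eqP/contraT => p_neq0.
(* These are [size p] distinct roots, one more than the degree. *)
have := @max_poly_roots _ p [seq i%:Z | i <- iota 0 (size p)] p_neq0.
rewrite size_map size_iota ltnn => ->//.
  by apply/allP => x _; rewrite /root p0.
by rewrite map_inj_uniq ?iota_uniq // => i j [].
Qed.

(** Induction on the number of variables: [muni] views p as a univariate polynomial in the last
    variable, and by the univariate case each of its coefficients vanishes at every integer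
    point. *)
Lemma mpoly_int_eq0 n (p : {mpoly int[n]}) : (forall v, p.@[v] = 0) -> p = 0.
Proof.
elim: n p => [|n IH] p p0.
  have X1 (m : 'X_{1..0}) : m = 0%MM by apply/mnmP => -[].
  have := p0 (fun=> 0); rewrite mevalE.
  under eq_bigr do rewrite big_ord0 mulr1.
  move=> s0; rewrite [p]mpolyE -[RHS](scale0r 1) -s0 scaler_suml.
  by apply: eq_bigr => m _; rewrite {2}(X1 m) mpolyX0.
pose wd (i : 'I_n) := widen_ord (leqnSn n) i.
have mu v : p.@[v] = (map_poly (meval (v \o wd)) (muni p)).[v ord_max].
  rewrite muniE mevalE rmorph_sum horner_sum; apply: eq_bigr => m _.
  rewrite big_ord_recr /= map_polyZ map_polyXn hornerZ hornerXn /= mevalZ mevalX mulrA.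
  by congr (_ * _ * _); apply: eq_bigr => i _; rewrite mnmE.
have muni0 : muni p = 0.
  apply/polyP => k; rewrite coef0; apply: IH => v.
  rewrite -coef_map; have -> : map_poly (meval v) (muni p) = 0; last by rewrite coef0.
  apply: poly_int_eq0 => x.
  pose v' (i : 'I_n.+1) := if insub (val i) is Some j then v j else x.
  have := p0 v'; rewrite mu /v' /= insubF ?ltnn //.
  rewrite (@eq_map_poly _ _ _ (meval v)) // => q.
  by apply: meval_eq => i /=; rewrite valK.
(* The coefficient of m in p is recovered from [muni p]: take degree [m ord_max] in the last
   variable and the restriction [m1] of m to the others. *)
apply/mpolyP => m; rewrite mcoeff0.
pose m1 : 'X_{1..n} := [multinom m (wd i) | i < n].
transitivity (((muni p)`_(m ord_max))@_m1); last by rewrite muni0 coef0 mcoeff0.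
rewrite muniE {1}[p]mpolyE coef_sum !raddf_sum /=; apply: eq_bigr => m' _.
rewrite coefZ coefXn mulr_natr mcoeffMn !mcoeffZ !mcoeffX -mulrnAr -mulrnA mulnb.
congr (_ * (nat_of_bool _)%:R); apply/eqP/andP => [->|[/eqP/mnmP e1 /eqP e2]].
  by rewrite !eqxx.
apply/mnmP => i; have [lt_in|] := ltnP i n.
  have -> : i = wd (Ordinal lt_in) by apply: val_inj.
  by have := e1 (Ordinal lt_in); rewrite !mnmE.
move=> le_ni; have -> // : i = ord_max.
by apply: val_inj; apply/eqP; rewrite eqn_leq le_ni -ltnS ltn_ord.
Qed.

(** * Comparison with the big Witt product *)

Lemma mpoly_int_torsion_free N (p : {mpoly int[N]}) m :
  (0 < m)%N -> p *+ m = 0 -> p = 0.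
Proof.
move=> m_gt0 pm0; apply/mpolyP => k; rewrite mcoeff0; apply/eqP.
have := congr1 (mcoeff k) pm0; rewrite mcoeffMn mcoeff0 => /eqP.
by rewrite Num.Theory.mulrn_eq0 eqn0Ngt m_gt0.
Qed.

Lemma rmorph_dlog_ene (R : comNzRingType) (K : closedFieldType)
    (phi : {rmorphism R -> K}) (F G : unit_series R) n :
  [pchar K] =i pred0 -> phi (dlog (ene F G) n + dlog F n * dlog G n) = 0.
Proof.
move=> pchar0; rewrite rmorphD rmorphM -!dlog_map us_map_ene.
by rewrite dlog_ene_closed ?addNr.
Qed.

Lemma dlog_ene_mpoly N (F G : unit_series {mpoly int[N]}) n :
  dlog (ene F G) n = - (dlog F n * dlog G n).
Proof.
apply/eqP; rewrite -addr_eq0; apply/eqP/mpoly_int_eq0 => v.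
(* Evaluation at the integer point v, followed by the embedding of Z into algC. *)
have [phi phiE] : exists phi : {rmorphism {mpoly int[N]} -> algC},
    forall p, p.@[v]%:~R = phi p.
  by exists (mmap intr (intr \o v)) => p; rewrite /meval rmorph_mmap.
apply/eqP; rewrite -(intr_eq0 algC) phiE; apply/eqP.
exact/rmorph_dlog_ene/Num.Theory.pchar_num.
Qed.

Lemma dlog_twisted_ene_mpoly N (F G : unit_series {mpoly int[N]}) n :
  dlog (twisted_ene F G) n = dlog F n * dlog G n.
Proof. by rewrite dlogV dlog_ene_mpoly opprK. Qed.

(** The twisted product of two generic series. Since [varU n k] and [varV n k] are 0 for k > n, it
    is universal only modulo X^(n+1). *)
Definition witt_generic n : unit_series {mpoly int[n + n]} :=
  twisted_ene (witt_prod (varU n)) (witt_prod (varV n)).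

Lemma agree_witt_generic (R : comNzRingType) d n (u v : nat -> R) : (d <= n)%N ->
  agree d (us_map (eval_at n u v) (witt_generic n))
    (twisted_ene (witt_prod u) (witt_prod v)).
Proof.
move=> le_dn; rewrite us_map_twisted_ene !us_map_witt_prod.
by apply: agree_twisted_ene; apply: agree_witt_prod => k /andP[k_gt0 le_kd];
  rewrite /= ?eval_at_varU ?eval_at_varV // k_gt0 (leq_trans le_kd).
Qed.

(** Coordinates are found without division, so those of the generic product lie in Z[U, V]; the d-th
    one serves as M_d. Its ghost equation is the formula for [dlog] of a twisted product. *)
Lemma witt_polys_exist : exists M, witt_polys_spec M.
Proof.
exists (fun d => witt_coord (witt_generic d) d) => n n_gt0.
have -> : ghost (fun d => eval2 (witt_coord (witt_generic d) d) (varU n) (varV n)) n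
    = ghost (witt_coord (witt_generic n)) n.
  apply: eq_big_seq => d.
  rewrite -(dvdn_divisors _ n_gt0) => dn.
  have d_gt0 := dvdn_gt0 n_gt0 dn; have le_dn := dvdn_leq n_gt0 dn.
  suff -> : eval2 (witt_coord (witt_generic d) d) (varU n) (varV n) =
    witt_coord (witt_generic n) d by [].
  (* [phi] renames 2d variables into 2n variables. It maps one generic product to the other modulo
     X^(d+1), which determines the coordinates up to d. *)
  rewrite -eval_atE; set phi := eval_at d _ _.
  apply: (@witt_prod_inj _ d (phi \o witt_coord (witt_generic d))); last first.
    by rewrite d_gt0 /=.
  rewrite -us_map_witt_prod !witt_coordK; exact: agree_witt_generic.
rewrite -!dlog_witt_prod // witt_coordK; exact: dlog_twisted_ene_mpoly.
Qed.

Lemma witt_polysP : witt_polys_spec witt_polys.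
Proof. exact: (epsilon_spec _ _ witt_polys_exist). Qed.

(** Ghost components are logarithmic derivatives and Z[U, V] is torsion-free, so the ghost equations
    force the polynomials chosen by [epsilon] to give the generic product. *)
Lemma agree_witt_polys_generic n :
  agree n (witt_prod (fun k => eval2 (witt_polys k) (varU n) (varV n))) (witt_generic n).
Proof.
apply: agree_of_dlog => [p m|m le_mn]; first exact: mpoly_int_torsion_free.
have [->|m_gt0] := posnP m; first by rewrite !dlog0.
rewrite dlog_twisted_ene_mpoly !dlog_witt_prod //.
(* The ghost equation of index m is stated in 2m variables; [phi] carries it to 2n variables. *)
pose phi : {rmorphism {mpoly int[m + m]} -> {mpoly int[n + n]}} :=
  eval_at m (varU n) (varV n).
have phiU k : (0 < k <= m)%N -> phi (varU m k) = varU n k by apply: eval_at_varU.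
have phiV k : (0 < k <= m)%N -> phi (varV m k) = varV n k by apply: eval_at_varV.
have ghostE x y : (forall k, (0 < k <= m)%N -> phi (x k) = y k) ->
    ghost y m = phi (ghost x m).
  move=> exy; rewrite -ghost_map; apply: eq_big_seq => d.
  rewrite -(dvdn_divisors _ m_gt0) => dm.
  by rewrite /= exy // (dvdn_gt0 m_gt0 dm) dvdn_leq.
rewrite (ghostE _ _ phiU) (ghostE _ _ phiV) -rmorphM -(witt_polysP m_gt0).
apply: ghostE => k /andP[_ le_km]; rewrite -eval2_map.
apply: eq_eval2 => i /andP[i_gt0 le_ik]; rewrite /= ?phiU ?phiV // i_gt0.
  exact: leq_trans le_km.
exact: leq_trans le_km.
Qed.

(** Write f and g as Witt products and specialize U, V to their coordinates, one degree at a time: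
    degree n uses the generic product in 2n variables. *)
Lemma witt_mul_nz (A : comNzRingType) (f g : unit_series A) :
  witt_mul f g = twisted_ene f g.
Proof.
apply: unit_seriesP => n; rewrite /witt_mul.
set x := witt_coord f; set y := witt_coord g.
rewrite -[f in RHS]witt_coordK -[g in RHS]witt_coordK -/x -/y.
rewrite -(agree_witt_generic x y (leqnn n)) //.
rewrite -[RHS]/(eval_at n x y (witt_generic n n)) -agree_witt_polys_generic //.
rewrite -[RHS]/(us_map (eval_at n x y) _ n) us_map_witt_prod.
apply: (@agree_witt_prod _ n) => // k /andP[_ le_kn] /=.
rewrite -eval2_map; apply: eq_eval2 => i /andP[i_gt0 le_ik] /=.
  by rewrite eval_at_varU // i_gt0 (leq_trans le_ik).
by rewrite eval_at_varV // i_gt0 (leq_trans le_ik).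
Qed.

Theorem theorem0p14 (A : comPzRingType) (f g : unit_series A) :
  witt_mul f g = twisted_ene f g.
Proof.
move: f g; have [A0|A_nz] := eqVneq (1 : A) 0.
  (* In the zero ring any two series coincide. *)
  by move=> f g; apply: unit_seriesP => n; rewrite -[LHS]mulr1 -[RHS]mulr1 A0 !mulr0.
(* [ComPzRing.type] has no eta-conversion: [A] must be a manifest pack for the
   ring underlying [A'] to be convertible to it. *)
case: A A_nz => T cT A_nz f g.
pose A := GRing.ComPzRing.Pack cT.
pose nz := GRing.PzSemiRing_isNonZero.Build A A_nz.
pose A' : comNzRingType := HB.pack T (GRing.ComPzRing.on A) nz.
exact: (@witt_mul_nz A' f g).
Qed.
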